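(* Let $P\subseteq\mathbb{R}^d$ be a finite set of $n$ points with doubling dimension $\delta$, let $k$ be an integer with $1\le k\le n$, let $\epsilon\in(0,1]$ and let $m\ge1$ be an integer. Let $\mathcal{S}=\{S_r\}_{r\ge0}$ be the sparse $k$th order Čech filtration of $P$ built with parameter $\epsilon'=\epsilon/3$ (defined in the context). Then the number of $(m-1)$-simplices of $\mathcal{S}$ (i.e. of $\bigcup_{r\ge0}S_r$) is at most \[ n\cdot\Gamma^{km}=n\,k^{km}\left(\frac{96}{\epsilon}\right)^{\delta k m},\qquad\text{where }\Gamma=k\left(\frac{96}{\epsilon}\right)^{\delta}. \]
   Context: **Doubling dimension.** $P$ is viewed as a finite metric space with the Euclidean metric. Its doubling constant $\Delta$ is the smallest integer such that every ball of any radius $r$ can be covered by at most $\Delta$ balls of radius $r/2$; the doubling dimension is $\delta=\log_2\Delta$. **k-distance permutation.** For a finite set $Q$ with $|Q|\ge k$, $\operatorname{d}^k(x,Q)$ is the distance from $x$ to its $k$th closest point in $Q$. The $k$-distance permutation is an ordering $p_1,\dots,p_n$ of $P$, with $P_i=\{p_1,\dots,p_i\}$, in which $p_1,\dots,p_k$ are arbitrary distinct points of $P$ and, for $k<i\le n$, $p_i\in\operatorname{argmax}_{q\in P\setminus P_{i-1}}\operatorname{d}^k(q,P_{i-1})$. Set $\lambda_1=\dots=\lambda_k=\infty$ and $\lambda_i=\operatorname{d}^k(p_i,P_{i-1})$ for $i>k$. **Freezing lenses, with parameter $\epsilon'=\epsilon/3$.** For a $k$-subset $A$ of $P$, $L_r(A)=\bigcap_{a\in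 A}B_r(a)$ with $B_r(a)$ the closed ball of radius $r$ around $a$. Put $\operatorname{frz}(p_i)=\frac{(1+\epsilon')\lambda_i}{\epsilon'}$ and $\operatorname{frz}(A)=\min_{p\in A}\operatorname{frz}(p)$. Define $\widetilde L_r(A)=L_r(A)$ if $r<\operatorname{frz}(A)$; $\widetilde L_r(A)=L_{\operatorname{frz}(A)}(A)$ if $\operatorname{frz}(A)\le r\le(1+\epsilon')\operatorname{frz}(A)$; $\widetilde L_r(A)=\emptyset$ if $r>(1+\epsilon')\operatorname{frz}(A)$. **Sparse filtration.** $C_r(A)=\bigcup_{\alpha\in[0,r]}\widetilde L_\alpha(A)\times\{\alpha\}\subseteq\mathbb{R}^d\times\mathbb{R}$. $S_r$ is the nerve of the family $\{C_r(A)\}_{A\in\binom{P}{k}}$: its simplices are the non-empty sets $\{A_1,\dots,A_m\}$ of ($m$ distinct) $k$-subsets of $P$ with $\bigcap_j C_r(A_j)\ne\emptyset$ (such a set is an $(m-1)$-simplex). $\mathcal{S}=\{S_r\}_{r\ge0}$. *)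

(* Defs.v *)
From HB Require Import structures.
From mathcomp Require Import all_boot all_order all_algebra finmap.
From mathcomp Require Import all_classical all_reals all_analysis.

Set Implicit Arguments.
Unset Strict Implicit.
Unset Printing Implicit Defensive.

Import Order.TTheory GRing.Theory Num.Theory.

Local Open Scope classical_set_scope.
Local Open Scope ring_scope.

(* The canonical norm of 'rV[R]_d is the sup norm, hence this explicit         *)
(* Euclidean distance.                                                         *)
Definition edist (R : realType) (d : nat) (x y : 'rV[R]_d) : R :=
  Num.sqrt (\sum_(i < d) (x 0 i - y 0 i) ^+ 2).

Definition eball (R : realType) (d : nat) (c : 'rV[R]_d) (r : R) :
    set 'rV[R]_d :=
  [set x | edist x c <= r].

(* Balls of the metric space P itself: both the covered and the covering balls *)
(* are centred at points of P. Since P is finite, open balls would give the    *)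
(* same doubling constant.                                                     *)
Definition doubling_bound (R : realType) (d : nat) (P : {fset 'rV[R]_d})
    (D : nat) : Prop :=
  forall (c : 'rV[R]_d) (r : R), c \in P ->
  exists C : {fset 'rV[R]_d},
    [/\ (C `<=` P)%fset, (#|` C|%fset <= D)%N &
        ([set` P] `&` eball c r `<=`
           \bigcup_(c' in [set` C]) eball c' (r / 2))%classic].

Lemma doubling_bound_ex (R : realType) (d : nat) (P : {fset 'rV[R]_d}) :
  exists D : nat, `[< doubling_bound P D >].
Proof.
exists #|` P|%fset; apply/asboolP => c r cP; exists P; split=> // x [/= xP xr].
have d0 (u : 'rV[R]_d) : edist u u = 0.
  by rewrite /edist big1 ?sqrtr0// => i _; rewrite subrr expr0n.
exists x => //=; rewrite /eball /= d0 divr_ge0//.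
by apply: le_trans xr; rewrite /edist sqrtr_ge0.
Qed.

Definition doubling_constant (R : realType) (d : nat)
    (P : {fset 'rV[R]_d}) : nat :=
  ex_minn (doubling_bound_ex P).

Definition doubling_dim (R : realType) (d : nat) (P : {fset 'rV[R]_d}) : R :=
  ln (doubling_constant P)%:R / ln 2.

(* Distance from x to its k-th closest point of Q, for 1 <= k <= #|` Q|.       *)
Definition kdist (R : realType) (d k : nat) (x : 'rV[R]_d)
    (Q : {fset 'rV[R]_d}) : R :=
  nth 0 (sort <=%R [seq edist x q | q <- enum_fset Q]) k.-1.

(* The sequence s is indexed from 0: p_(i+1) is nth 0 s i, and P_i is          *)
(* prefix_fset s i.                                                            *)
Definition prefix_fset (R : realType) (d : nat) (s : seq 'rV[R]_d) (i : nat) :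
    {fset 'rV[R]_d} :=
  [fset x in take i s]%fset.

Definition kdist_permutation (R : realType) (d k : nat) (P : {fset 'rV[R]_d})
    (s : seq 'rV[R]_d) : Prop :=
  [/\ uniq s, s =i P &
      forall i : nat, (k <= i < size s)%N ->
      forall q : 'rV[R]_d, q \in (P `\` prefix_fset s i)%fset ->
        kdist k q (prefix_fset s i) <= kdist k (nth 0 s i) (prefix_fset s i)].

Definition lambda (R : realType) (d k : nat) (s : seq 'rV[R]_d)
    (p : 'rV[R]_d) : \bar R :=
  if (index p s < k)%N then +oo%E
  else (kdist k p (prefix_fset s (index p s)))%:E.

Definition frz_pt (R : realType) (d k : nat) (s : seq 'rV[R]_d) (e : R)
    (p : 'rV[R]_d) : \bar R :=
  (((1 + e) / e)%:E * lambda k s p)%E.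

Definition frz (R : realType) (d k : nat) (s : seq 'rV[R]_d) (e : R)
    (A : {fset 'rV[R]_d}) : \bar R :=
  \big[Order.min/+oo%E]_(p <- enum_fset A) frz_pt k s e p.

Definition lens (R : realType) (d : nat) (r : R) (A : {fset 'rV[R]_d}) :
    set 'rV[R]_d :=
  \bigcap_(a in [set` A]) eball a r.

(* In the second case frz A <= r%:E, so that frz A is finite.                  *)
Definition frz_lens (R : realType) (d k : nat) (s : seq 'rV[R]_d) (e r : R)
    (A : {fset 'rV[R]_d}) : set 'rV[R]_d :=
  if (r%:E < frz k s e A)%E then lens r A
  else if (r%:E <= (1 + e)%:E * frz k s e A)%E then
    lens (fine (frz k s e A)) A
  else set0.

Definition sparse_cover (R : realType) (d k : nat) (s : seq 'rV[R]_d)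
    (e r : R) (A : {fset 'rV[R]_d}) : set ('rV[R]_d * R) :=
  \bigcup_(alpha in `[0, r]) (frz_lens k s e alpha A `*` [set alpha]).

Definition ksubsets (K : choiceType) (P : {fset K}) (k : nat) :
    {fset {fset K}} :=
  [fset A in fpowerset P | #|` A|%fset == k]%fset.

Definition nerve (I : choiceType) (T : Type) (V : {fset I})
    (F : I -> set T) : {fset {fset I}} :=
  [fset sigma in fpowerset V |
     (sigma != fset0) &&
     `[< (\bigcap_(i in [set` sigma]) F i !=set0)%classic >]]%fset.

Definition sparse_cech (R : realType) (d k : nat) (P : {fset 'rV[R]_d})
    (s : seq 'rV[R]_d) (e r : R) : {fset {fset {fset 'rV[R]_d}}} :=
  nerve (ksubsets P k) (sparse_cover k s e r).

(* The simplices of dimension m - 1 of the union of all S_r with r >= 0.       *)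
Definition sparse_cech_simplices (R : realType) (d k : nat)
    (P : {fset 'rV[R]_d}) (s : seq 'rV[R]_d) (e : R) (m : nat) :
    {fset {fset {fset 'rV[R]_d}}} :=
  [fset sigma in fpowerset (ksubsets P k) |
     (#|` sigma|%fset == m) &&
     `[< exists2 r : R, 0 <= r & sigma \in sparse_cech k P s e r >]]%fset.

(* Main.v *)
(* Charge each simplex {A_1, ..., A_m} to the vertex p = p_i of A_1 U ... U A_m *)
(* that comes last in the permutation, and write e = eps/3. A common point of  *)
(* the frozen lenses lies within frz(p) of p and, since the lenses are empty   *)
(* beyond (1 + e) frz(A_j), within (1 + e) frz(p) of the other vertices, so    *)
(* all vertices lie in P_i and within (2 + e) frz(p) of p. The lambda_j        *)
(* decrease, so a subset of P_i of diameter less than lambda_i has at most k   *)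
(* points; halving the radius (2 + e) frz(p) about log_2 (96 / eps) times brings *)
(* the diameter of balls below lambda_i, which leaves at most Gamma possible   *)
(* vertices, hence at most (Gamma^k)^m simplices charged to p.                 *)
Require Import Defs.
From HB Require Import structures.
From mathcomp Require Import all_boot all_order all_algebra finmap.
From mathcomp Require Import all_classical all_reals all_analysis.
From mathcomp Require Import ring lra.
(* Unshadows edist, which mathcomp-analysis defines too. *)
Import Defs.

Set Implicit Arguments.
Unset Strict Implicit.

Import Order.TTheory GRing.Theory Num.Theory.

Local Open Scope ring_scope.

(** This is a packing argument. [sparse_cech_prefix_near] confines a simplex charged to [p] to the
    point set [prefix_near k s e p], and [card_prefix_near] bounds that set by Gamma. The second
    bound combines two facts: [card_prefix_clump] says that a cluster of P_i narrower than lambda_i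
    has at most k points, and [doubling_card] says that t halvings of a ball leave at most D^t
    clusters, D being the doubling constant. As frz(p) is lambda_i times a factor of order 1/eps, t
    depends on eps alone, and D^t = (2^t)^delta is at most (96/eps)^delta. Applying
    [card_ksubsets_le] twice passes from points to simplices. *)

(** * Counting in finite sets *)

Lemma card_fset_filter (K : choiceType) (Q : {fset K}) (p : pred K) :
  #|` [fset q in Q | p q]|%fset = count p (enum_fset Q).
Proof.
rewrite -size_filter; apply: perm_size; apply: uniq_perm => [||q].
- exact: fset_uniq.
- by rewrite filter_uniq ?fset_uniq.
- by rewrite mem_filter !inE andbC.
Qed.

(** Union bound, used for k-subsets, for coverings by balls and for charging simplices. *)
Lemma card_fset_cover (K : choiceType) (I : eqType) (F : I -> {fset K})
    (r : seq I) (X : {fset K}) :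
  (forall x, x \in X -> exists2 i, i \in r & x \in F i) ->
  (#|` X| <= \sum_(i <- r) #|` F i|)%N.
Proof.
elim: r X => [|i r IHr] X XF.
  rewrite big_nil leqn0 cardfs_eq0; apply/eqP/fsetP => x; rewrite inE.
  by apply/negP => /XF[].
rewrite big_cons -(cardfsID (F i) X) leq_add ?fsubset_leq_card ?fsubsetIr//.
apply: IHr => x; rewrite in_fsetD => /andP[xFi /XF[j]].
rewrite in_cons => /predU1P[->|jr xFj]; last by exists j.
by rewrite (negPf xFi).
Qed.

Lemma mem_ksubsets (K : choiceType) (X A : {fset K}) (k : nat) :
  (A \in ksubsets X k) = (A `<=` X)%fset && (#|` A| == k).
Proof. by rewrite !inE fpowersetE. Qed.

(** A set of k + 1 elements is one of its elements added to a k-subset. This crude bound, unlike a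
    binomial coefficient, iterates to a single power. *)
Lemma card_ksubsets_le (K : choiceType) (X : {fset K}) (k : nat) :
  (#|` ksubsets X k| <= #|` X| ^ k)%N.
Proof.
elim: k => [|k IHk].
  rewrite expn0 -(cardfs1 (@fset0 K)); apply/fsubset_leq_card/fsubsetP => A.
  by rewrite mem_ksubsets cardfs_eq0 inE => /andP[].
rewrite expnS.
pose F x := [fset (x |` B)%fset | B in ksubsets X k]%fset.
apply: (@leq_trans (\sum_(x <- enum_fset X) #|` F x|)).
  apply: card_fset_cover => A; rewrite mem_ksubsets => /andP[AX /eqP cA].
  have /fset0Pn[x xA] : A != fset0 by rewrite -cardfs_eq0 cA.
  exists x; first exact: (fsubsetP AX).
  apply/imfsetP; exists (A `\ x)%fset => /=; last by rewrite fsetD1K.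
  rewrite mem_ksubsets (fsubset_trans (fsubsetDl _ _) AX)/=.
  by have := cardfsD1 x A; rewrite xA cA add1n => -[->].
rewrite (leq_trans (n := \sum_(x <- enum_fset X) #|` X| ^ k)%N)//.
  by apply: leq_sum => x _; rewrite (leq_trans (leq_imfset_card _ _ _)) /=.
by rewrite big_const_seq count_predT iter_addn_0 mulnC.
Qed.

Lemma fset_argmax (K : choiceType) (X : {fset K}) (f : K -> nat) :
  X != fset0 -> exists2 x, x \in X & forall y, y \in X -> (f y <= f x)%N.
Proof.
case/fset0Pn => x0 x0X.
case: (@arg_maxnP X [` x0X]%fset xpredT (fun x => f (val x)) isT) => x _ xmax.
by exists (val x) => [|y yX]; [exact: valP | exact: (xmax [` yX]%fset)].
Qed.

(** * Euclidean distance *)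

Lemma sum_CauchySchwarz (R : realType) (d : nat) (a b : 'I_d -> R) :
  (\sum_i a i * b i) ^+ 2 <= (\sum_i a i ^+ 2) * (\sum_i b i ^+ 2).
Proof.
set A := \sum_i a i ^+ 2; set B := \sum_i b i ^+ 2; set C := \sum_i a i * b i.
have B0 : 0 <= B by apply: sumr_ge0 => i _; exact: sqr_ge0.
have : 0 <= \sum_i (B * a i - C * b i) ^+ 2.
  by apply: sumr_ge0 => i _; exact: sqr_ge0.
have expand u v : \sum_i (u * a i - v * b i) ^+ 2
    = u ^+ 2 * A - 2 * u * v * C + v ^+ 2 * B.
  rewrite /A /B /C !mulr_sumr -sumrB -big_split/=.
  by apply: eq_bigr => i _; ring.
rewrite expand (_ : _ + _ = B * (A * B - C ^+ 2)); last by ring.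
have [B_gt0|] := ltP 0 B; first by rewrite pmulr_rge0// subr_ge0.
move=> Ble0 _; have {Ble0}B_eq0 : B = 0 by apply/le_anti/andP.
have b0 i : b i = 0.
  have /allP/(_ i) := etrans (esym (psumr_eq0 _ (fun i _ => sqr_ge0 (b i))))
    (introT eqP B_eq0).
  by rewrite mem_index_enum sqrf_eq0 => /(_ isT)/eqP.
by rewrite /C big1 ?expr0n ?B_eq0 ?mulr0//= => i _; rewrite b0 mulr0.
Qed.

Lemma edist_ge0 (R : realType) (d : nat) (x y : 'rV[R]_d) : 0 <= edist x y.
Proof. exact: sqrtr_ge0. Qed.

Lemma edistC (R : realType) (d : nat) (x y : 'rV[R]_d) : edist x y = edist y x.
Proof. by congr Num.sqrt; apply: eq_bigr => i _; ring. Qed.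

Lemma edist_le0 (R : realType) (d : nat) (x y : 'rV[R]_d) :
  (edist x y <= 0) = (x == y).
Proof.
rewrite le_eqVlt ltNge edist_ge0 orbF sqrtr_eq0 le_eqVlt ltNge.
rewrite sumr_ge0 ?orbF => [|i _]; last exact: sqr_ge0.
rewrite psumr_eq0 => [|i _]; last exact: sqr_ge0.
apply/allP/eqP => [xy|-> i _]; last by rewrite subrr expr0n /=.
apply/rowP => i; apply/eqP; rewrite -subr_eq0 -sqrf_eq0.
exact: (xy i (mem_index_enum i)).
Qed.

Lemma edist_triangle (R : realType) (d : nat) (z x y : 'rV[R]_d) :
  edist x y <= edist x z + edist z y.
Proof.
have sq0 (a b : 'rV[R]_d) : 0 <= \sum_(i < d) (a 0 i - b 0 i) ^+ 2.
  by apply: sumr_ge0 => i _; exact: sqr_ge0.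
rewrite -(@ler_pXn2r _ 2) ?nnegrE ?addr_ge0 ?edist_ge0//.
rewrite sqrrD /edist !sqr_sqrtr// -sqrtrM//.
pose S := \sum_(i < d) (x 0 i - z 0 i) * (z 0 i - y 0 i).
apply: (@le_trans _ _ (\sum_(i < d) (x 0 i - z 0 i) ^+ 2 + S *+ 2 +
    \sum_(i < d) (z 0 i - y 0 i) ^+ 2)).
  rewrite -sumrMnl -!big_split/=; apply: ler_sum => i _.
  by rewrite le_eqVlt; apply/orP; left; apply/eqP; ring.
rewrite lerD2r lerD2l lerMn2r/= (le_trans (ler_norm _))//.
by rewrite -sqrtr_sqr ler_wsqrtr ?sum_CauchySchwarz.
Qed.

(** * The kth distance and the greedy permutation *)

(** Turns the entry of a sorted list into a count of near points, so that later arguments never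
    unfold [kdist]. The bounds on k keep [nth] away from its default value. *)
Lemma kdist_le (R : realType) (d k : nat) (x : 'rV[R]_d) (Q : {fset 'rV[R]_d})
    (v : R) : (0 < k <= #|` Q|)%N ->
  (kdist k x Q <= v) = (k <= #|` [fset q in Q | (edist x q <= v)%R]|%fset)%N.
Proof.
case/andP => k0 kQ; rewrite card_fset_filter /kdist.
set l := [seq edist x q | q <- enum_fset Q].
have -> : count (fun q => edist x q <= v) (enum_fset Q)
    = count (<= v) (sort <=%R l).
  by rewrite (permP (permEl (perm_sort _ _))) count_map.
have srt : sorted <=%R (sort <=%R l) by apply: sort_sorted => a b; exact: le_total.
have szl : size (sort <=%R l) = #|` Q| by rewrite size_sort size_map.
rewrite -{2}(prednK k0); have [kc|ck] := ltnP k.-1 _.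
  exact: (nth_count_le 0 srt kc).
apply/negbTE; rewrite -ltNge; apply: (nth_count_gt 0 srt).
by rewrite ck szl prednK.
Qed.

Lemma kdist_gt0 (R : realType) (d k : nat) (x : 'rV[R]_d)
    (Q : {fset 'rV[R]_d}) :
  (0 < k <= #|` Q|)%N -> x \notin Q -> 0 < kdist k x Q.
Proof.
move=> kQ xQ; rewrite ltNge kdist_le//; apply/negP => kX.
have : [fset q in Q | edist x q <= 0]%fset != fset0.
  by rewrite -cardfs_eq0 -lt0n (leq_trans _ kX)//; case/andP: kQ.
case/fset0Pn => q; rewrite !inE edist_le0 => /andP[qQ /eqP xq].
by rewrite xq qQ in xQ.
Qed.

Lemma kdist_anti (R : realType) (d k : nat) (x : 'rV[R]_d)
    (Q Q' : {fset 'rV[R]_d}) :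
  (0 < k <= #|` Q|)%N -> (Q `<=` Q')%fset -> kdist k x Q' <= kdist k x Q.
Proof.
move=> /[dup] kQ /andP[k0 kQ1] QQ'.
have kQ' : (0 < k <= #|` Q'|)%N by rewrite k0 (leq_trans kQ1) ?fsubset_leq_card.
rewrite kdist_le//; have : kdist k x Q <= kdist k x Q by [].
rewrite {1}kdist_le// => /leq_trans; apply.
apply/fsubset_leq_card/fsubsetP => q; rewrite !inE => /andP[qQ ->].
by rewrite (fsubsetP QQ').
Qed.

Lemma mem_prefix_fset (R : realType) (d : nat) (s : seq 'rV[R]_d) (i : nat)
    (q : 'rV[R]_d) :
  (q \in prefix_fset s i) = (q \in s) && (index q s < i)%N.
Proof.
rewrite /prefix_fset in_fset /=.
case: (boolP (q \in s)) => [/in_take -> //|qs] /=.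
by apply: contraNF qs => /mem_take.
Qed.

Lemma card_prefix_fset (R : realType) (d : nat) (s : seq 'rV[R]_d) (i : nat) :
  uniq s -> (i <= size s)%N -> #|` prefix_fset s i| = i.
Proof.
by move=> us si; rewrite card_fseq undup_id ?take_uniq// size_takel.
Qed.

(** The later point was still a candidate when the earlier one was chosen, and enlarging the prefix
    only lowers its kth distance. *)
Lemma kdist_greedy_anti (R : realType) (d k : nat) (P : {fset 'rV[R]_d})
    (s : seq 'rV[R]_d) (i j : nat) :
  kdist_permutation k P s -> (0 < k)%N -> (k <= i <= j)%N -> (j < size s)%N ->
  kdist k (nth 0 s j) (prefix_fset s j) <= kdist k (nth 0 s i) (prefix_fset s i).
Proof.
case=> us sP greedy k0 /andP[ki ij] js; have is_ := leq_ltn_trans ij js.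
apply: (@le_trans _ _ (kdist k (nth 0 s j) (prefix_fset s i))).
  apply: kdist_anti; first by rewrite k0 card_prefix_fset// ltnW.
  apply/fsubsetP => q; rewrite !mem_prefix_fset => /andP[->] /leq_trans.
  exact.
apply: greedy; first by rewrite ki.
by rewrite in_fsetD -sP mem_nth// mem_prefix_fset mem_nth//= index_uniq// -leqNgt ij.
Qed.

(* The last of k + 1 points of P_(i+1) has the k others before it, hence a     *)
(* point at distance at least lambda_(i+1) among them.                         *)
Lemma card_prefix_clump (R : realType) (d k : nat) (P : {fset 'rV[R]_d})
    (s : seq 'rV[R]_d) (i : nat) (X : {fset 'rV[R]_d}) (v : R) :
  kdist_permutation k P s -> (0 < k)%N -> (i < size s)%N ->
  (X `<=` prefix_fset s i.+1)%fset ->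
  (forall x y, x \in X -> y \in X -> edist x y <= v) ->
  v < kdist k (nth 0 s i) (prefix_fset s i) ->
  (#|` X| <= k)%N.
Proof.
move=> perm k0 is_ Xs Xv; rewrite ltNge; apply: contraR; rewrite -ltnNge => kX.
have [us _ _] := perm.
have /(fset_argmax (index^~ s))[p pX pmax] : X != fset0.
  by rewrite -cardfs_eq0 -lt0n (leq_ltn_trans _ kX).
have /andP[ps pi] : (p \in s) && (index p s < i.+1)%N.
  by rewrite -mem_prefix_fset (fsubsetP Xs).
set j := index p s in pmax pi.
have js : (j < size s)%N by rewrite index_mem.
have kX' : (k <= #|` X `\ p|%fset)%N.
  by move: kX; rewrite (cardfsD1 p) pX.
have X's : (X `\ p `<=` prefix_fset s j)%fset.
  apply/fsubsetP => q; rewrite in_fsetD1 => /andP[qp qX].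
  have qs : q \in s.
    by move/fsubsetP: Xs => /(_ q qX); rewrite mem_prefix_fset => /andP[].
  rewrite mem_prefix_fset qs ltn_neqAle pmax// andbT.
  by apply: contra qp => /eqP qp; rewrite -(nth_index 0 qs) qp nth_index.
have cj : #|` prefix_fset s j| = j by rewrite card_prefix_fset// ltnW.
(* The point [p] has k points before it, so its lambda is finite and can be compared with the one at
   [i], as j <= i. *)
have kj : (k <= j)%N.
  by rewrite -[leqRHS]cj (leq_trans kX')// fsubset_leq_card.
apply: (@le_trans _ _ (kdist k (nth 0 s j) (prefix_fset s j))).
  by apply: kdist_greedy_anti perm k0 _ is_; rewrite kj.
rewrite kdist_le ?k0 ?cj//.
apply: (leq_trans kX'); apply/fsubset_leq_card/fsubsetP => q qX'.
rewrite in_fset /= inE (fsubsetP X's)//= nth_index// Xv//.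
by move: qX'; rewrite in_fsetD1 => /andP[].
Qed.

(** * Packing by repeated halving *)

(** Each halving replaces a ball by at most [D] balls. Their centres lie in [P] again, so the
    covering can be repeated until radius [r]. *)
Lemma doubling_card (R : realType) (d D K t : nat) (P Q : {fset 'rV[R]_d})
    (r : R) (c : 'rV[R]_d) :
  doubling_bound P D -> (Q `<=` P)%fset ->
  (forall b, b \in P -> (#|` [fset q in Q | (edist q b <= r)%R]|%fset <= K)%N) ->
  c \in P ->
  (#|` [fset q in Q | (edist q c <= 2 ^+ t * r)%R]|%fset <= D ^ t * K)%N.
Proof.
move=> dbl QP small; elim: t c => [|t IHt] c cP.
  by rewrite expr0 mul1r expn0 mul1n small.
have [C [CP CD cover]] := dbl c (2 ^+ t.+1 * r) cP.
apply: (@leq_trans (\sum_(b <- enum_fset C)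
    #|` [fset q in Q | (edist q b <= 2 ^+ t * r)%R]|%fset)).
  apply: card_fset_cover => q; rewrite !inE => /andP[qQ qc].
  have [|b bC qb] := cover q.
    by split; [exact: (fsubsetP QP)|].
  exists b => //; rewrite !inE qQ/=.
  by apply: le_trans qb _; rewrite exprS; lra.
apply: (@leq_trans (\sum_(b <- enum_fset C) D ^ t * K)%N).
  rewrite big_seq [leqRHS]big_seq; apply: leq_sum => b bC.
  by apply: IHt; exact: (fsubsetP CP).
rewrite big_const_seq count_predT iter_addn_0 expnS mulnC -mulnA.
by rewrite leq_mul2r CD orbT.
Qed.

(** Here t is the integer part of log_2 y, the number of halvings: the upper bound on y makes the
    last radius small, the lower one bounds the number of balls. *)
Lemma pow2_bracket (R : realType) (y : R) :
  1 <= y -> exists t : nat, 2 ^+ t <= y < 2 ^+ t.+1.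
Proof.
move=> y1; have yT : y < 2 ^+ (Num.trunc y).+1.
  rewrite (lt_trans (truncnS_gt y))// -natrX ltr_nat.
  exact: ltn_expl.
have [|t ty tmin] := @ex_minnP (fun t => y < 2 ^+ t).
  by exists (Num.trunc y).+1.
case: t ty tmin => [|t] ty tmin; first by rewrite expr0 ltNge y1 in ty.
by exists t; rewrite ty andbT leNgt; apply/negP => /tmin; rewrite ltnn.
Qed.

Lemma doubling_constantP (R : realType) (d : nat) (P : {fset 'rV[R]_d}) :
  doubling_bound P (doubling_constant P).
Proof. by rewrite /doubling_constant; case: ex_minnP => D /asboolP. Qed.

(** Even a ball of radius 0 needs a covering ball; hence the logarithm defining the dimension is a
    genuine one. *)
Lemma doubling_constant_gt0 (R : realType) (d : nat) (P : {fset 'rV[R]_d}) :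
  P != fset0 -> (0 < doubling_constant P)%N.
Proof.
case/fset0Pn => c cP; have [C [_ CD cover]] := doubling_constantP 0 cP.
have [|b bC _] := cover c; first by split=> //; rewrite /eball /= edist_le0.
by apply: leq_trans CD; rewrite cardfs_gt0; apply/fset0Pn; exists b.
Qed.

Lemma powR2_doubling_dim (R : realType) (d : nat) (P : {fset 'rV[R]_d}) :
  P != fset0 -> 2 `^ doubling_dim P = (doubling_constant P)%:R.
Proof.
move=> P0; have D0 : 0 < (doubling_constant P)%:R :> R.
  by rewrite ltr0n doubling_constant_gt0.
have ln2 : ln 2 != 0 :> R by rewrite gt_eqF// ln_gt0// ltr1n.
by rewrite /powR pnatr_eq0/= /doubling_dim divfK// lnK.
Qed.

Lemma doubling_dim_ge0 (R : realType) (d : nat) (P : {fset 'rV[R]_d}) :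
  P != fset0 -> 0 <= doubling_dim P.
Proof.
move=> P0; rewrite divr_ge0// ln_ge0 ?ler1n//.
exact: doubling_constant_gt0.
Qed.

(** * Frozen lenses and the vertices of a simplex *)

Lemma frz_lensP (R : realType) (d k : nat) (s : seq 'rV[R]_d) (e r : R)
    (A : {fset 'rV[R]_d}) (x a : 'rV[R]_d) :
  0 <= e -> 0 <= r -> frz_lens k s e r A x -> a \in A ->
  [/\ edist x a <= r, ((edist x a)%:E <= frz k s e A)%E
    & (r%:E <= (1 + e)%:E * frz k s e A)%E].
Proof.
move=> e0 r0; rewrite /frz_lens; have e1 : 0 < 1 + e by lra.
case: (frz k s e A) => [f| |]; rewrite ?lte_fin ?ltry ?ltNge ?leNye//=.
- rewrite -EFinM !lee_fin; case: ltP => [rf xA aA|fr].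
    have := xA a aA; rewrite /eball /= => xa; split=> //; first by lra.
    by nra.
  by case: ifP => // rf xA aA; have := xA a aA; rewrite /eball /= => xa; split; lra.
- move=> xA aA; have := xA a aA; rewrite /eball /= => xa; split=> //.
    by rewrite leey.
  by rewrite gt0_muley ?leey ?lte_fin.
- by rewrite gt0_muleNy ?lte_fin.
Qed.

(* The vertices that a simplex can have when p is its last vertex. *)
Definition prefix_near (R : realType) (d k : nat) (s : seq 'rV[R]_d) (e : R)
    (p : 'rV[R]_d) : {fset 'rV[R]_d} :=
  [fset q in prefix_fset s (index p s).+1 |
     ((edist q p)%:E <= (2 + e)%:E * frz_pt k s e p)%E]%fset.

Lemma sparse_cech_prefix_near (R : realType) (d k m : nat)
    (P : {fset 'rV[R]_d}) (s : seq 'rV[R]_d) (e : R)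
    (sigma : {fset {fset 'rV[R]_d}}) :
  kdist_permutation k P s -> (0 < k)%N -> 0 <= e ->
  sigma \in sparse_cech_simplices k P s e m ->
  exists2 p, p \in P & sigma \in ksubsets (ksubsets (prefix_near k s e p) k) m.
Proof.
case=> us sP _ k0 e0; rewrite in_fset /= inE fpowersetE.
case/andP => sigmaP /andP[csigma /asboolP[r r0]].
rewrite in_fset /= inE => /andP[_ /andP[sigma0 /asboolP[[x al] xal]]].
(* The last coordinate of a common point is the scale, so all lenses are taken at the same [al]. *)
have xA A : A \in sigma -> 0 <= al /\ frz_lens k s e al A x.
  move=> Asigma; have [be] := xal A Asigma.
  by rewrite /= in_itv/= => /andP[be0 _] [/= xA ->].
have sub A : A \in sigma -> (A `<=` P)%fset && (#|` A| == k).
  by rewrite -mem_ksubsets; exact: (fsubsetP sigmaP).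
pose U := (\bigcup_(A <- enum_fset sigma) A)%fset.
have UP q : reflect (exists2 A, A \in sigma & q \in A) (q \in U).
  apply: (iffP (bigfcupP _ _ _ _)) => -[A As qA]; exists A => //.
    by case/andP: As.
  by rewrite andbT.
have /(fset_argmax (index^~ s))[p /UP[A As pA] pmax] : U != fset0.
  have /fset0Pn[A As] := sigma0; have /andP[_ /eqP cA] := sub A As.
  have /fset0Pn[q qA] : A != fset0 by rewrite -cardfs_eq0 cA -lt0n.
  by apply/fset0Pn; exists q; apply/UP; exists A.
have Psub B q : B \in sigma -> q \in B -> q \in P.
  by move=> /sub/andP[/fsubsetP BP _]; exact: BP.
exists p; first exact: Psub pA.
rewrite mem_ksubsets csigma andbT; apply/fsubsetP => B Bs.
rewrite mem_ksubsets; have /andP[_ ->] := sub B Bs; rewrite andbT.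
apply/fsubsetP => q qB; rewrite in_fset /= inE mem_prefix_fset sP.
rewrite (Psub B)//= ltnS pmax/=; last by apply/UP; exists B.
(* As [A] contains [p], its lens bounds both [al] and [edist x p] through frz(p); the lens of [B]
   gives [edist x q <= al]. *)
have [al0 xinA] := xA A As; have [_ xinB] := xA B Bs.
have [_ xp alp] := frz_lensP e0 al0 xinA pA.
have [xq _ _] := frz_lensP e0 al0 xinB qB.
have fp : (frz k s e A <= frz_pt k s e p)%E by apply: ge_bigmin_seq.
have tri : edist q p <= al + edist x p.
  by rewrite (le_trans (edist_triangle x q p))// lerD2r edistC.
apply: (@le_trans _ _ (al%:E + (edist x p)%:E)%E); first by rewrite -EFinD lee_fin.
have f0 : (0 <= frz_pt k s e p)%E.
  by rewrite (le_trans _ (le_trans xp fp))// lee_fin edist_ge0.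
rewrite (_ : 2 + e = (1 + e) + 1); last by ring.
rewrite EFinD ge0_muleDl ?lee_fin ?addr_ge0// mul1e.
apply: leeD; last exact: le_trans fp.
by rewrite (le_trans alp)// lee_wpmul2l// lee_fin addr_ge0.
Qed.

Lemma card_prefix_near (R : realType) (d k : nat) (P : {fset 'rV[R]_d})
    (s : seq 'rV[R]_d) (eps : R) (p : 'rV[R]_d) :
  kdist_permutation k P s -> (0 < k)%N -> 0 < eps <= 1 -> p \in P ->
  #|` prefix_near k s (eps / 3) p|%:R
    <= k%:R * (96 / eps) `^ doubling_dim P.
Proof.
move=> perm k0 /andP[eps0 eps1] pP; have [us sP _] := perm.
have P0 : P != fset0 by apply/fset0Pn; exists p.
have delta0 := doubling_dim_ge0 P0.
have eps96 : 1 <= 96 / eps by rewrite ler_pdivlMr//; lra.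
have ps : p \in s by rewrite sP.
set i := index p s; have is_ : (i < size s)%N by rewrite index_mem.
have nearP : (prefix_near k s (eps / 3) p `<=` prefix_fset s i.+1)%fset.
  by apply/fsubsetP => q; rewrite in_fset /= inE => /andP[].
(* For i < k the freezing value is infinite and the distance condition void, but the prefix has only
   i + 1 <= k points. *)
have [ik|ki] := ltnP i k.
  apply: (@le_trans _ _ k%:R).
    rewrite ler_nat (leq_trans (fsubset_leq_card nearP))//.
    by rewrite card_prefix_fset.
  by rewrite ler_peMr// -[leLHS](powRr0 (96 / eps)) ler_powR//.
set la := kdist k p (prefix_fset s i).
have la0 : 0 < la.
  apply: kdist_gt0; first by rewrite k0 card_prefix_fset// ltnW.
  by rewrite mem_prefix_fset ltnn andbF.
have frzE : frz_pt k s (eps / 3) p = ((1 + eps / 3) / (eps / 3) * la)%:E.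
  by rewrite /frz_pt /lambda -/i ltnNge ki.
have [t /andP[tlo thi]] : exists t, 2 ^+ t <= 96 / eps < 2 ^+ t.+1.
  exact: pow2_bracket.
(* After t halvings of (2 + eps / 3) frz(p), balls have diameter below lambda. *)
pose rho := (2 + eps / 3) * ((1 + eps / 3) / (eps / 3) * la) / 2 ^+ t.
(* The choice of t gives eps 2^t > 48, while 2 (2 + eps/3) (3 + eps) is at most 56/3 because eps <=
   1. *)
have rho_la : rho + rho < la.
  have t0 : 0 < 2 ^+ t :> R by rewrite exprn_gt0.
  have {thi} : 48 < eps * 2 ^+ t.
    by move: thi; rewrite ltr_pdivrMr// exprS; lra.
  set T := 2 ^+ t in t0 *.
  move=> thi.
  rewrite (_ : rho + rho =
    2 * (2 + eps / 3) * (3 + eps) * la / (eps * T)); last first.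
    by rewrite /rho -/T; field; rewrite !gt_eqF.
  rewrite ltr_pdivrMr ?mulr_gt0//.
  rewrite mulrC ltr_pM2l//.
  nra.
pose Q := prefix_fset s i.+1.
have QP : (Q `<=` P)%fset.
  by apply/fsubsetP => q; rewrite mem_prefix_fset sP => /andP[].
have small b : b \in P ->
    (#|` [fset q in Q | (edist q b <= rho)%R]|%fset <= k)%N.
  move=> bP; apply: (@card_prefix_clump _ _ _ P s i _ (rho + rho)) => //.
  - by apply/fsubsetP => q; rewrite in_fset /= inE => /andP[].
  - move=> x y; rewrite !in_fset /= !inE => /andP[_ xb] /andP[_ yb].
    by rewrite (le_trans (edist_triangle b x y))// lerD// edistC.
  - by rewrite nth_index.
have := doubling_card t (@doubling_constantP _ _ P) QP small pP.
rewrite /rho mulrC divfK ?gt_eqF ?exprn_gt0// => card_near.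
apply: (@le_trans _ _ (doubling_constant P ^ t * k)%:R).
  rewrite ler_nat (leq_trans _ card_near)//.
  apply/fsubset_leq_card/fsubsetP => q; rewrite !in_fset /= !inE frzE.
  by rewrite -EFinM lee_fin.
(* With D = 2^delta, the factor D^t becomes (2^t)^delta, and 2^t <= 96/eps. *)
rewrite natrM natrX mulrC ler_pM2l ?ltr0n// -powR2_doubling_dim//.
rewrite -powR_mulrn ?powR_ge0// -powRrM mulrC powRrM powR_mulrn//.
by rewrite ge0_ler_powR// nnegrE ?exprn_ge0// (le_trans _ eps96).
Qed.

Unset Implicit Arguments.
Set Strict Implicit.

(** * Summing over the charged points *)

Theorem theorem13 (R : realType) (d n k m : nat) (P : {fset 'rV[R]_d})
    (s : seq 'rV[R]_d) (eps : R)
    (cardP : #|` P|%fset = n) (k_bounds : (1 <= k <= n)%N)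
    (eps_bounds : 0 < eps <= 1) (m_ge1 : (1 <= m)%N)
    (sP : kdist_permutation k P s) :
  let delta := doubling_dim P in
  let Gamma := k%:R * (96 / eps) `^ delta in
  #|` sparse_cech_simplices k P s (eps / 3) m|%fset%:R
    <= n%:R * Gamma ^+ (k * m) /\
  n%:R * Gamma ^+ (k * m)
    = n%:R * k%:R ^+ (k * m) * (96 / eps) `^ (delta * k%:R * m%:R).
Proof.
move=> delta Gamma; have /andP[k0 _] := k_bounds; split; last first.
  rewrite /Gamma exprMn mulrA; congr *%R.
  by rewrite -powR_mulrn ?powR_ge0// -powRrM natrM mulrA.
have e0 : 0 <= eps / 3 by case/andP: eps_bounds => /ltW; lra.
pose N p := ksubsets (ksubsets (prefix_near k s (eps / 3) p) k) m.
apply: (@le_trans _ _ (\sum_(p <- enum_fset P) #|` N p|)%:R).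
  rewrite ler_nat; apply: card_fset_cover => sigma.
  exact: sparse_cech_prefix_near.
rewrite natr_sum -cardP.
apply: (@le_trans _ _ (\sum_(p <- enum_fset P) Gamma ^+ (k * m))); last first.
  by rewrite big_const_seq count_predT iter_addr_0 mulr_natl.
rewrite big_seq [leRHS]big_seq; apply: ler_sum => p pP.
apply: (@le_trans _ _ (#|` prefix_near k s (eps / 3) p|%:R ^+ (k * m))).
  rewrite -natrX ler_nat expnM (leq_trans (card_ksubsets_le _ _))//.
  by rewrite leq_exp2r// card_ksubsets_le.
by rewrite lerXn2r ?nnegrE// ?card_prefix_near// mulr_ge0// powR_ge0.
Qed.
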